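(* Let $(\mathcal{A},\mathcal{B},\mathfrak{F},d,\tau)$ be a fusion bialgebra and let $P,Q$ be projections in $\mathcal{A}$. Then the following are equivalent: (1) $\mathcal{S}(P*Q)=\mathcal{S}(P)$; (2) $\frac{1}{\mathcal{S}(Q)}P*Q$ is a projection; (3) there is a biprojection $B$ such that $Q\le B_h$ and $P=\mathcal{R}(x*B)$ for some $x\ne0$ in $\mathcal{A}$, where $B_h$ is a right shift of $B$.
   Context: Fusion bialgebra: let $\mathcal{A}$ and $\mathcal{B}$ be finite-dimensional $C^*$-algebras with faithful (positive) traces $d$ and $\tau$ respectively, with $\mathcal{A}$ commutative. The multiplication and involution of $\mathcal{A}$ are written $\diamond$ and $\#$, those of $\mathcal{B}$ are written $xy$ and $*$. Let $\mathfrak{F}:\mathcal{A}\to\mathcal{B}$ be a unitary transformation preserving 2-norms, i.e. a linear bijection with $\tau(\mathfrak{F}(x)^*\mathfrak{F}(y))=d(x^\#\diamond y)$ for all $x,y\in\mathcal{A}$. The convolution on $\mathcal{A}$ is $x*y:=\mathfrak{F}^{-1}(\mathfrak{F}(x)\mathfrak{F}(y))$. The quintuple $(\mathcal{A},\mathcal{B},\mathfrak{F},d,\tau)$ is a fusion bialgebra if: (1) for $x,y\ge0$ in $\mathcal{A}$, $x*y\ge0$ in $\mathcal{A}$; (2) $J(x):=\mathfrak{F}^{-1}(\mathfrak{F}(x)^* )$ is an anti-linear $*$-isomorphism on $\mathcal{A}$; (3) $\mathfrak{F}^{-1}(1_{\mathcal{B}})$ is a positive multiple of a minimal projection in $\mathcal{A}$.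 For $x\in\mathcal{A}$, $\mathcal{R}(x)$ is its range projection in $\mathcal{A}$ and $\mathcal{S}(x)=d(\mathcal{R}(x))$. A biprojection is a projection $B\in\mathcal{A}$ such that $\mathfrak{F}(B)$ is a multiple of a projection in $\mathcal{B}$. A projection $R\in\mathcal{A}$ is a right shift of a biprojection $B$ if $d(B)=d(R)$ and $B*R=d(B)R$.
   Formalization: Added: d is multiplicative for convolution, d(x*y)=d(x)d(y), without which the equivalence fails (e.g. A=B=C, F(x)=2x, P=Q=1); Q is nonzero, so that 1/S(Q) makes sense; and if P=0 then dim A is at least 2, since (3) fails for A=C, P=0, Q=1. *)

(* Defs.v *)
From HB Require Import structures.
From mathcomp Require Import all_boot all_order all_algebra all_field.
From mathcomp Require Import complex.
From mathcomp Require Import boolp classical_sets reals.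

Set Implicit Arguments.
Unset Strict Implicit.
Unset Printing Implicit Defensive.

Import Order.TTheory GRing.Theory Num.Theory.
Local Open Scope ring_scope.

(* A falgType is a finite-dimensional, unital, nonzero algebra, so the norm is
   automatically complete. The zero C*-algebra is excluded; it cannot occur in
   a fusion bialgebra, whose commutative side has a minimal projection. *)
HB.mixin Record Falgebra_isCstar (R : realType) (A : Type)
    of Falgebra R[i] A := {
  star : A -> A;
  cnorm : A -> R;
  starD : forall x y : A, star (x + y) = star x + star y;
  starZ : forall (a : R[i]) (x : A), star (a *: x) = Num.conj a *: star x;
  starM : forall x y : A, star (x * y) = star y * star x;
  starK : forall x : A, star (star x) = x;
  cnorm_ge0 : forall x : A, 0 <= cnorm x;
  cnorm0_eq0 : forall x : A, cnorm x = 0 -> x = 0;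
  cnormD : forall x y : A, cnorm (x + y) <= cnorm x + cnorm y;
  cnormZ : forall (a : R[i]) (x : A), cnorm (a *: x) = Normc.normc a * cnorm x;
  cnormM : forall x y : A, cnorm (x * y) <= cnorm x * cnorm y;
  cnorm_star : forall x : A, cnorm (star x * x) = cnorm x ^+ 2
}.

#[short(type="finCstarAlgType")]
HB.structure Definition FinCstarAlgebra (R : realType) :=
  { A of Falgebra_isCstar R A & Falgebra R[i] A }.

Section Cstar.
Variables (R : realType) (A : finCstarAlgType R).

Definition cpos (x : A) : Prop := exists y : A, x = star y * y.

Definition cle (x y : A) : Prop := cpos (y - x).

Definition projection (p : A) : Prop := star p = p /\ p * p = p.

Definition minimal_projection (p : A) : Prop :=
  [/\ projection p, p <> 0 &
      forall q : A, projection q -> cle q p -> q = 0 \/ q = p].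

(* The order on R[i] makes [0 <= z] mean that z is real and nonnegative. *)
Definition faithful_trace (t : {scalar A}) : Prop :=
  [/\ forall x y : A, t (x * y) = t (y * x),
      forall x : A, 0 <= t (star x * x) &
      forall x : A, t (star x * x) = 0 -> x = 0].

Definition is_range_projection (x p : A) : Prop :=
  [/\ projection p, p * x = x &
      forall q : A, projection q -> q * x = x -> cle p q].

(* Such a p is unique since [cle] is antisymmetric, and it exists in every
   finite-dimensional C*-algebra, so the default value 0 is never used. *)
Definition range_projection (x : A) : A :=
  xget 0 [set p | is_range_projection x p]%classic.

End Cstar.

Section FusionBialgebra.
Variables (R : realType) (A B : finCstarAlgType R) (F : 'Hom(A, B)).

(* [F^-1%VF] is the two-sided inverse of F as soon as F is bijective. *)
Definition conv (x y : A) : A := (F^-1)%VF (F x * F y).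

Definition modular_conj (x : A) : A := (F^-1)%VF (star (F x)).

Definition antilinear_star_iso (J : A -> A) : Prop :=
  [/\ forall x y : A, J (x + y) = J x + J y,
      forall (a : R[i]) (x : A), J (a *: x) = Num.conj a *: J x,
      forall x y : A, J (x * y) = J x * J y,
      forall x : A, J (star x) = star (J x) &
      bijective J].

(* These axioms do not make d multiplicative for [conv]: take B = C[Z/2] with
   its canonical trace, A = C^2 with weights (1, t^2), t > 0, and F sending the
   minimal projections p0, p1 to the group elements g0, t g1. Then
   conv p1 p1 = t^2 p0, while d p1 * d p1 = t^4. *)
Record fusion_bialgebra (d : {scalar A}) (tau : {scalar B}) : Prop := {
  fb_commutative : forall x y : A, x * y = y * x;
  fb_d_trace : faithful_trace d;
  fb_tau_trace : faithful_trace tau;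
  fb_bijective : bijective F;
  fb_unitary : forall x y : A, tau (star (F x) * F y) = d (star x * y);
  fb_schur : forall x y : A, cpos x -> cpos y -> cpos (conv x y);
  fb_modular : antilinear_star_iso modular_conj;
  fb_jones : exists (c : R[i]) (e : A),
    [/\ 0 < c, minimal_projection e & (F^-1)%VF 1 = c *: e]
}.

Definition supp_size (d : {scalar A}) (x : A) : R[i] := d (range_projection x).

Definition biprojection (b : A) : Prop :=
  projection b /\
  exists (c : R[i]) (q : B), projection q /\ F b = c *: q.

Definition right_shift (d : {scalar A}) (b r : A) : Prop :=
  [/\ projection r, d b = d r & conv b r = d b *: r].

End FusionBialgebra.

(* Main.v *)
(* The algebra A is spanned by orthogonal atoms e_i, so its order, projections
   and ranges are read off coordinatewise.  Frobenius reciprocity and the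
   multiplicativity of d give 1 * y = d(y) 1, so convolving a projection P with
   y >= 0 yields an element below d(y) 1 of trace d(P) d(y); equality of traces
   then forces equality in order relations.  This gives (1) <-> (2) at once.
   For (2) -> (3), B is the sum of the atoms e_k with P * e_k = d(e_k) P; the
   positive y supported on B are exactly those with P * y = d(y) P, which makes
   B a biprojection.  If P * Q = d(Q) P', reciprocity gives P' * J(Q) = d(Q) P,
   so Q * J(Q) is supported on B, hence B * Q / d(Q) is a projection: it is the
   right shift containing Q.  If P = 0 then B = 1, and x is any nonzero element
   of the kernel of d.
   For (3) -> (2), z = x * B satisfies z * B = d(B) z, and so does |z|^2 by a
   Kadison-Schwarz argument, whence P * B = d(B) P.  As B_h * J(B_h) = d(B) B,
   the element P * B_h / d(B) is a projection of trace d(P); it dominates the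
   range of P * Q, and so equals P * Q / d(Q). *)
Require Import Defs.
From HB Require Import structures.
From mathcomp Require Import all_boot all_order all_algebra all_field.
From mathcomp Require Import complex.
From mathcomp Require Import boolp classical_sets reals.
From mathcomp Require Import ring.

Set Implicit Arguments.
Unset Strict Implicit.
Unset Printing Implicit Defensive.

Import Order.TTheory GRing.Theory Num.Theory.
Local Open Scope ring_scope.

(** * Minimal idempotents of a commutative reduced algebra *)

Section AtomicDecomposition.
Variables (K : closedFieldType) (A : falgType K).

(** The powers of [x] up to the dimension of [A] are one too many to be independent. *)
Lemma exists_annihilator (x : A) :
  exists2 p : {poly K}, p != 0 & horner_alg x p = 0.
Proof.
pose n := \dim {:A}.
pose X := [tuple x ^+ i | i < n.+1].
have [/freeP k_eq0|/freeP nfree] := boolP (free X).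
  exfalso; have : free X by apply/freeP.
  by move=> /eqP dimX; have := dimvS (subvf <<X>>); rewrite dimX size_tuple ltnn.
have [k [kX0 [i ki_neq0]]] : exists k : 'I_n.+1 -> K,
    \sum_(i < n.+1) k i *: X`_i = 0 /\ exists i, k i <> 0.
  apply: contrapT => nk; apply: nfree => k kX0 i; apply: contrapT => ki_neq0.
  by apply: nk; exists k; split => //; exists i.
exists (\poly_(i < n.+1) k (inord i)).
  apply/eqP => /(congr1 (fun p : {poly K} => p`_i)).
  by rewrite coef_poly ltn_ord inord_val coef0.
rewrite poly_def raddf_sum -[RHS]kX0; apply: eq_bigr => j _ /=.
rewrite linearZ rmorphXn /= horner_algX inord_val.
by rewrite mulr_algl (nth_map j) ?size_enum_ord // nth_ord_enum.
Qed.

Definition ideal (V : {vspace A}) : Prop :=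
  forall x v, v \in V -> x * v \in V.

(** The last clause says that [A e] is the line through [e]; in a commutative reduced algebra over a
    closed field these are the minimal idempotents. *)
Definition atom (e : A) : Prop :=
  [/\ e != 0, e * e = e & forall x, exists c : K, x * e = c *: e].

(** A polynomial annihilating [x] has a factor ['X - c] with cofactor [q]: either [q] at [x] already
    kills [v], and the degree drops, or it sends [v] to an eigenvector. *)
Lemma ideal_eigenvector (V : {vspace A}) (x v : A) :
    ideal V -> v \in V -> v != 0 ->
  exists c w, [/\ w \in V, w != 0 & x * w = c *: w].
Proof.
move=> idV; have [p p0 /(congr1 (fun y => y * v))] := exists_annihilator x.
rewrite mul0r; have [m] := ubnP (size p).
elim: m p p0 v => // m IH p p0 v szp pv0 vV v0.
have [/size_poly1P[c c0 pE]|/closed_rootP[c /factor_theorem[q pE]]] :=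
    boolP (size p == 1).
  move/eqP: pv0; rewrite pE horner_algC mulr_algl scaler_eq0.
  by rewrite (negPf c0) (negPf v0).
have q0 : q != 0 by apply: contraNneq p0 => q0; rewrite pE q0 mul0r.
have [qv0|qv0] := eqVneq (horner_alg x q * v) 0.
  apply: (IH q _ v) => //; move: szp; rewrite pE size_Mmonic ?monicXsubC //.
  by rewrite size_XsubC addn2.
exists c, (horner_alg x q * v); split => //; first exact: idV.
move: pv0; rewrite pE mulrC rmorphM rmorphB /= horner_algX horner_algC.
by rewrite -mulrA mulrBl mulr_algl => /eqP; rewrite subr_eq0 => /eqP.
Qed.

Hypothesis mulC : forall x y : A, x * y = y * x.
Hypothesis reduced : forall x : A, x * x = 0 -> x = 0.

(** If some [x] is not scalar on [V], an eigenspace of it in [V] is a smaller nonzero ideal.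
    Otherwise [v * v = c *: v], with [c] nonzero by reducedness, and [c^-1 *: v] is an atom. *)
Lemma ideal_atom (V : {vspace A}) (v : A) :
  ideal V -> v \in V -> v != 0 -> exists2 e, e \in V & atom e.
Proof.
have [m] := ubnP (\dim V); elim: m V v => // m IH V v dimV idV vV v0.
have [[x [c [w [wV w0 xw [u [uV xu]]]]]]|noW] :=
  EM (exists x c w, [/\ w \in V, w != 0, x * w = c *: w &
        exists u, u \in V /\ x * u <> c *: u]).
  pose W := (V :&: lker (amull (x - c%:A)))%VS.
  have WE y : (y \in W) = (y \in V) && (x * y == c *: y).
    by rewrite memv_cap memv_ker lfunE /= mulrBl mulr_algl subr_eq0.
  have [||||e] := IH W w.
  - rewrite -ltnS; apply: leq_trans dimV; rewrite ltnS.
    rewrite (ltn_leqif (dimv_leqif_sup (capvSl _ _))).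
    apply/negP => /subvP/(_ u uV); rewrite WE => /andP[_ /eqP]; exact: xu.
  - move=> y z; rewrite !WE => /andP[zV /eqP xz]; rewrite idV //=.
    by rewrite mulrA (mulC x) -mulrA xz -scalerAr.
  - by rewrite WE wV xw eqxx.
  - by [].
  by rewrite WE => /andP[eV _] eatom; exists e.
have scal x : exists c : K, forall u, u \in V -> x * u = c *: u.
  have [c [w [wV w0 xw]]] := ideal_eigenvector x idV vV v0.
  exists c => u uV; apply: contrapT => xu; apply: noW.
  by exists x, c, w; split => //; exists u.
have [c cE] := scal v.
have c0 : c != 0.
  by apply: contra_neq v0 => c0; apply: reduced; rewrite cE // c0 scale0r.
exists (c^-1 *: v); first exact: memvZ.
split.
- by rewrite scaler_eq0 invr_eq0 (negPf c0).
- by rewrite -scalerAl -scalerAr cE // (scalerA c^-1 c) mulVf // scale1r.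
- move=> x; have [a aE] := scal x; exists a; rewrite aE //; exact: memvZ.
Qed.

(** An atom [e] of the ideal [p A] splits off, and the induction continues with [p - e], whose ideal
    is smaller. *)
Lemma idempotent_atoms (p : A) : p * p = p ->
  exists s : seq A, [/\ uniq s, forall e, e \in s -> atom e,
    {in s &, forall e f, e != f -> e * f = 0} & \sum_(e <- s) e = p].
Proof.
have [m] := ubnP (\dim (limg (amull p))); elim: m p => // m IH p dimp pp.
have [->|p0] := eqVneq p 0; first by exists [::]; split; rewrite ?big_nil.
have limgP q y : q * q = q ->
    reflect (q * y = y) (y \in limg (amull q)).
  move=> qq; apply: (iffP idP) => [/memv_imgP[z _ ->]|<-].
    by rewrite lfunE /= mulrA qq.
  by have := memv_img (amull q) (memvf y); rewrite lfunE.
have idp : ideal (limg (amull p)).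
  move=> x v /limgP -/(_ pp) pv; apply/limgP => //.
  by rewrite mulrA (mulC p) -mulrA pv.
have pp_in : p \in limg (amull p) by apply/limgP.
have [e /limgP -/(_ pp) pe [e0 ee escal]] := ideal_atom idp pp_in p0.
have ep : e * p = e by rewrite mulC.
have qq : (p - e) * (p - e) = p - e.
  by rewrite mulrBl !mulrBr pp pe ep ee subrr subr0.
have [|s [uniq_s atoms orth sumE]] := IH (p - e) _ qq.
  rewrite -ltnS; apply: leq_trans dimp; rewrite ltnS.
  have sub : (limg (amull (p - e)) <= limg (amull p))%VS.
    apply/subvP => x /limgP -/(_ qq) qx; apply/limgP => //.
    by rewrite -qx mulrA mulrBr pp pe.
  rewrite (ltn_leqif (dimv_leqif_sup sub)).
  apply/negP => /subvP/(_ e) sube.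
  have /sube/limgP -/(_ qq)/eqP : e \in limg (amull p) by apply/limgP.
  by rewrite mulrBl pe ee subrr eq_sym (negPf e0).
(* Each atom [f] of [p - e] is absorbed by [p - e], which [e] annihilates. *)
have orthe f : f \in s -> e * f = 0.
  move=> fs; have [f0 ff _] := atoms f fs.
  have <- : f * (p - e) = f.
    rewrite -sumE mulr_sumr (bigD1_seq f) //= ff big_seq_cond big1 ?addr0 // => g.
    by case/andP=> gs gf; rewrite orth // eq_sym.
  by rewrite (mulC f) mulrA mulrBr ep ee subrr mul0r.
have eNs : e \notin s.
  by apply: contra_neqN e0 => /orthe; rewrite ee.
exists (e :: s); split.
- by rewrite /= eNs.
- by move=> f; rewrite inE => /predU1P[->|/atoms//]; split.
- move=> f g; rewrite !inE => /predU1P[->|fs] /predU1P[->|gs].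
  + by rewrite eqxx.
  + by rewrite orthe.
  + by rewrite mulC orthe.
  + exact: orth.
- by rewrite big_cons sumE addrC subrK.
Qed.
End AtomicDecomposition.

(** * Commutative C*-algebras with a faithful trace *)

Section Coordinates.
Variables (R : realType) (A : finCstarAlgType R) (d : {scalar A}).

(** For an atom [e] this is the character of [A] at [e]; the trace formula makes it linear for every
    [e]. *)
Definition coord (e x : A) : R[i] := d (x * e) / d e.

Fact coord_is_linear (e : A) : scalar (coord e).
Proof. by move=> a x y; rewrite /coord mulrDl -scalerAl linearP /= mulrDl mulrA. Qed.

HB.instance Definition _ (e : A) :=
  GRing.isLinear.Build R[i] A R[i] *%R (coord e) (coord_is_linear e).

Lemma coordB (e x y : A) : coord e (x - y) = coord e x - coord e y.
Proof. exact: linearB. Qed.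

Lemma coordZ (e : A) (a : R[i]) (x : A) : coord e (a *: x) = a * coord e x.
Proof. exact: linearZ. Qed.

Definition atomic_basis (n : nat) (e : 'I_n -> A) : Prop :=
  [/\ forall i, atom (e i), forall i j, i != j -> e i * e j = 0 &
      \sum_i e i = 1].

Hypothesis mulC : forall x y : A, x * y = y * x.
Hypothesis tr : faithful_trace d.

Lemma starN (x : A) : star (- x) = - star x.
Proof. by rewrite -scaleN1r starZ rmorphN1 scaleN1r. Qed.

Lemma starB (x y : A) : star (x - y) = star x - star y.
Proof. by rewrite starD starN. Qed.

Lemma star1 : star 1 = 1 :> A.
Proof. by rewrite -[LHS]mulr1 -[X in _ * X](starK 1) -starM mulr1 starK. Qed.

(** Faithfulness acts twice: [h = star x * x] is self-adjoint of square zero, so [h = 0], and then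
    [x = 0]. *)
Lemma reduced (x : A) : x * x = 0 -> x = 0.
Proof.
have [_ _ faith] := tr => xx0; apply: (faith); set h := star x * x.
have hh : star h = h by rewrite starM starK.
suff -> : h = 0 by rewrite linear0.
apply: faith; rewrite hh /h mulrA -(mulrA (star x) x) (mulC x) !mulrA -mulrA xx0.
by rewrite mulr0 linear0.
Qed.

(** The product of [p - star p * p] with its adjoint vanishes, so [p] equals the self-adjoint
    [star p * p]. *)
Lemma idempotent_star (p : A) : p * p = p -> star p = p.
Proof.
have [_ _ faith] := tr => pp.
have spp : star p * star p = star p by rewrite -starM pp.
have /eqP : p - star p * p = 0.
  apply: faith; rewrite starB starM starK mulrBl !mulrBr.
  have sh : star p * (star p * p) = star p * p by rewrite mulrA spp.
  have hp : star p * p * p = star p * p by rewrite -mulrA pp.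
  have hh : star p * p * (star p * p) = star p * p.
    by rewrite mulrA (mulC _ (star p)) mulrA spp hp.
  by rewrite sh hp hh !subrr linear0.
by rewrite subr_eq0 => /eqP pE; rewrite {1}pE starM starK.
Qed.

Lemma exists_atomic_basis : exists (n : nat) (e : 'I_n -> A), atomic_basis e.
Proof.
have [s [uniq_s atoms orth sum1]] := idempotent_atoms mulC reduced (mulr1 1).
exists (size s), (tnth (in_tuple s)); split.
- by move=> i; apply/atoms/mem_tnth.
- move=> i j ij; apply: orth; rewrite ?mem_tnth //.
  by apply: contra ij; rewrite !(tnth_nth 0) nth_uniq.
- by rewrite -sum1 [RHS]big_tnth.
Qed.

(** * Order, projections and trace in atomic coordinates *)

Variables (n : nat) (e : 'I_n -> A).
Hypothesis basis : atomic_basis e.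

Local Notation chi i := (coord (e i)).

Lemma star_atom i : star (e i) = e i.
Proof. by have [/(_ i)[_ ee _] _ _] := basis; apply: idempotent_star. Qed.

Lemma d_atom_gt0 i : 0 < d (e i).
Proof.
have [_ pos faith] := tr; have [/(_ i)[e0 ee _] _ _] := basis.
have := pos (e i); have := faith (e i); rewrite star_atom ee => de0.
by rewrite le_eqVlt => /predU1P[/esym/de0/eqP|//]; rewrite (negPf e0).
Qed.

Lemma coordE i (x : A) : x * e i = chi i x *: e i.
Proof.
have [/(_ i)[_ _ /(_ x)[c xe]] _ _] := basis.
by rewrite /coord xe linearZ /= mulfK // gt_eqF // d_atom_gt0.
Qed.

Lemma coord_atom i j : chi i (e j) = (i == j)%:R.
Proof.
have [/(_ i)[_ ee _] orth _] := basis; rewrite /coord.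
have [<-|ij] := eqVneq; first by rewrite ee divff // gt_eqF // d_atom_gt0.
by rewrite orth 1?eq_sym // linear0 mul0r.
Qed.

Lemma coord_sum (f : 'I_n -> R[i]) i : chi i (\sum_j f j *: e j) = f i.
Proof.
rewrite linear_sum (bigD1 i) //= linearZ /= coord_atom eqxx mulr1 big1 ?addr0 //.
by move=> j ji; rewrite linearZ /= coord_atom eq_sym (negPf ji) mulr0.
Qed.

Lemma sum_coord (x : A) : x = \sum_i chi i x *: e i.
Proof.
have [_ _ sum1] := basis; rewrite -[LHS]mulr1 -sum1 mulr_sumr.
by apply: eq_bigr => i _; rewrite coordE.
Qed.

Lemma coord_inj (x y : A) : (forall i, chi i x = chi i y) -> x = y.
Proof.
by move=> xy; rewrite (sum_coord x) (sum_coord y); apply: eq_bigr => i _; rewrite xy.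
Qed.

Lemma coord1 i : chi i 1 = 1.
Proof. by rewrite /coord mul1r divff // gt_eqF // d_atom_gt0. Qed.

Lemma coordM i (x y : A) : chi i (x * y) = chi i x * chi i y.
Proof.
rewrite {1}/coord -mulrA coordE -scalerAr coordE scalerA linearZ /=.
by rewrite mulfK 1?mulrC // gt_eqF // d_atom_gt0.
Qed.

Lemma coord_star i (x : A) : chi i (star x) = (chi i x)^*.
Proof.
rewrite {1}/coord -{1}star_atom -starM mulC coordE starZ star_atom linearZ /=.
by rewrite mulfK // gt_eqF // d_atom_gt0.
Qed.

Lemma cposP (x : A) : cpos x <-> forall i, 0 <= chi i x.
Proof.
split=> [[y ->] i|x0].
  by rewrite coordM coord_star mulrC -normCK exprn_ge0.
(* The square root is taken coordinatewise. *)
exists (\sum_i sqrtC (chi i x) *: e i); apply: coord_inj => i.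
rewrite coordM coord_star coord_sum geC0_conj ?sqrtC_ge0 //.
by rewrite -expr2 sqrtCK.
Qed.

Lemma cleP (x y : A) : cle x y <-> forall i, chi i x <= chi i y.
Proof.
by rewrite /cle cposP; split=> xy i; move: (xy i); rewrite linearB subr_ge0.
Qed.

Lemma cpos_star (x : A) : cpos x -> star x = x.
Proof.
move=> /cposP x0; apply: coord_inj => i.
by rewrite coord_star geC0_conj.
Qed.

(** Having coordinates 0 or 1 is phrased as an equation that can be used for rewriting. *)
Lemma projectionP (p : A) : projection p <-> forall i, chi i p = (chi i p != 0)%:R.
Proof.
split=> [[_ pp] i|pE].
  have /eqP : chi i p * (chi i p - 1) = 0.
    by rewrite mulrBr mulr1 -coordM pp subrr.
  rewrite mulf_eq0 subr_eq0 => /orP[] /eqP ->; rewrite ?eqxx //.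
  by rewrite oner_eq0.
have pp : p * p = p.
  apply: coord_inj => i; rewrite coordM pE.
  by case: (_ == _); rewrite ?mul0r ?mul1r.
by split; first exact: idempotent_star.
Qed.

Lemma projection_cpos (p : A) : projection p -> cpos p.
Proof. by move=> /projectionP pE; apply/cposP => i; rewrite pE ler0n. Qed.

Lemma projection_cle1 (p : A) : projection p -> cle p 1.
Proof.
by move=> /projectionP pE; apply/cleP => i; rewrite pE coord1 lern1 leq_b1.
Qed.

Lemma d_sum (x : A) : d x = \sum_i chi i x * d (e i).
Proof.
by rewrite {1}(sum_coord x) linear_sum; apply: eq_bigr => i _; rewrite linearZ.
Qed.

Lemma d_star (x : A) : d (star x) = (d x)^*.
Proof.
rewrite !d_sum rmorph_sum; apply: eq_bigr => i _.
by rewrite rmorphM coord_star /= (geC0_conj (ltW (d_atom_gt0 i))).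
Qed.

Lemma d_ge0 (x : A) : cpos x -> 0 <= d x.
Proof.
move=> /cposP x0; rewrite d_sum sumr_ge0 // => i _.
by rewrite mulr_ge0 // ltW // d_atom_gt0.
Qed.

Lemma d_eq0 (x : A) : cpos x -> d x = 0 -> x = 0.
Proof.
move=> /cposP x0; rewrite d_sum => /psumr_eq0P dx0; apply: coord_inj => i.
have /eqP := dx0 (fun j _ => mulr_ge0 (x0 j) (ltW (d_atom_gt0 j))) i isT.
by rewrite linear0 mulf_eq0 (gt_eqF (d_atom_gt0 i)) orbF => /eqP.
Qed.

(** The difference is positive of trace zero. Most identities below are proved this way. *)
Lemma cle_d_eq (x y : A) : cle x y -> d x = d y -> x = y.
Proof.
move=> xy dxy; apply/esym/eqP; rewrite -subr_eq0; apply/eqP.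
by apply: d_eq0 => //; rewrite linearB /= dxy subrr.
Qed.

Lemma d_projection_gt0 (p : A) : projection p -> p <> 0 -> 0 < d p.
Proof.
move=> /projection_cpos p0 pn0; rewrite lt_neqAle d_ge0 // andbT eq_sym.
by apply/eqP => /(d_eq0 p0).
Qed.

Lemma projection1 : projection (1 : A).
Proof. by split; rewrite ?star1 ?mulr1. Qed.

Lemma d1_gt0 : 0 < d 1.
Proof. by apply: d_projection_gt0; [exact: projection1|exact/eqP/oner_neq0]. Qed.

Lemma d_nondegenerate (x y : A) :
  (forall z, d (star x * z) = d (star y * z)) -> x = y.
Proof.
have [_ _ faith] := tr => xy; apply/eqP; rewrite -subr_eq0; apply/eqP/faith.
by rewrite starB mulrBl linearB /= xy subrr.
Qed.

Lemma cposZ (a : R[i]) (x : A) : 0 <= a -> cpos x -> cpos (a *: x).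
Proof.
by move=> a0 /cposP x0; apply/cposP => i; rewrite linearZ /= mulr_ge0.
Qed.

Lemma cpos_atom i : cpos (e i).
Proof. by apply/cposP => j; rewrite coord_atom ler0n. Qed.

(** * Trace tests for projections, and range projections *)

Lemma mul_projection_d_eq (p u : A) :
  projection p -> cpos u -> d (p * u) = d u -> p * u = u.
Proof.
move=> pP /cposP u0; apply: cle_d_eq; apply/cleP => i.
have /cleP/(_ i) := projection_cle1 pP; rewrite coord1 coordM => p1.
by rewrite -[leRHS]mul1r ler_wpM2r.
Qed.

(** Supported on [p] and bounded by [a], the element [u] lies below [a *: p], and the traces
    agree. *)
Lemma squeeze_projection (a : R[i]) (p u : A) :
    projection p -> p * u = u -> cle u (a *: 1) -> d u = a * d p ->
  u = a *: p.
Proof.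
move=> pP pu /cleP u1 du; apply: cle_d_eq; last by rewrite linearZ.
apply/cleP => i; rewrite linearZ /= -pu coordM mulrC.
apply: ler_wpM2r; first by have /projection_cpos/cposP := pP.
by have := u1 i; rewrite linearZ /= coord1 mulr1.
Qed.

(** From [0 <= y <= 1] follows [y * y <= y]; equal traces make it an equality. *)
Lemma projection_of_d_sqr (y : A) :
  cpos y -> cle y 1 -> d (y * y) = d y -> projection y.
Proof.
move=> y0 /cleP y1 dyy; split; first exact: cpos_star.
apply: cle_d_eq dyy; apply/cleP => i; rewrite coordM.
rewrite -[leRHS]mul1r ler_wpM2r //; first by move/cposP: y0.
by rewrite -(coord1 i).
Qed.

Lemma range_projectionE (x : A) :
  range_projection x = \sum_i (chi i x != 0)%:R *: e i.
Proof.
set p := \sum_i _; have pE i : chi i p = (chi i x != 0)%:R by apply: coord_sum.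
have pP : projection p.
  by apply/projectionP => i; rewrite pE; case: (_ == _); rewrite ?oner_eq0 ?eqxx.
have px : p * x = x.
  apply: coord_inj => i; rewrite coordM pE.
  by case: eqP => [->|_]; rewrite ?mulr0 ?mul1r.
have pmin q : projection q -> q * x = x -> cle p q.
  move=> /projectionP qE qx; apply/cleP => i; rewrite pE.
  have := congr1 (chi i) qx; rewrite coordM qE.
  case: (chi i q != 0) => [_|]; first by rewrite lern1 leq_b1.
  by rewrite mul0r => <-; rewrite eqxx.
rewrite /range_projection; apply: xget_unique; first by split.
move=> q [qP qx qmin]; apply: coord_inj => i; apply/le_anti.
by have /cleP -> := qmin p pP px; have /cleP -> := pmin q qP qx.
Qed.

Lemma coord_range i (x : A) : chi i (range_projection x) = (chi i x != 0)%:R.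
Proof. by rewrite range_projectionE coord_sum. Qed.

Lemma projection_range (x : A) : projection (range_projection x).
Proof.
by apply/projectionP => i; rewrite coord_range; case: eqP; rewrite ?eqxx ?oner_eq0.
Qed.

Lemma range_projection_id (p : A) : projection p -> range_projection p = p.
Proof.
by move=> /projectionP pE; apply: coord_inj => i; rewrite coord_range -pE.
Qed.

Lemma range_projectionZ (a : R[i]) (x : A) :
  a != 0 -> range_projection (a *: x) = range_projection x.
Proof.
move=> a0; apply: coord_inj => i.
by rewrite !coord_range linearZ /= mulf_eq0 (negPf a0).
Qed.

Lemma d_le (x y : A) : cle x y -> d x <= d y.
Proof. by move=> /d_ge0; rewrite linearB subr_ge0. Qed.

Lemma cle_mul_projection (p q : A) :
  projection p -> projection q -> p * q = q -> cle q p.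
Proof.
move=> pP qP pq; apply/cleP => i; rewrite -pq coordM.
have /cleP/(_ i) := projection_cle1 qP; rewrite coord1 => q1.
rewrite -[leRHS]mulr1 ler_wpM2l //; by have /projection_cpos/cposP := pP.
Qed.

Lemma mul_projection_cle (a : R[i]) (p u : A) :
  projection p -> cpos u -> cle u (a *: p) -> p * u = u.
Proof.
move=> /projectionP pE /cposP u0 /cleP up; apply: coord_inj => i.
have := up i; rewrite coordM linearZ /= pE; case: eqP => _; rewrite ?mul1r //.
by rewrite mulr0 mul0r => ui; apply/esym/le_anti; rewrite ui u0.
Qed.

(** * Convolution and Frobenius reciprocity *)

Section Fusion.
Variables (B : finCstarAlgType R) (F : 'Hom(A, B)) (tau : {scalar B}).
Hypothesis fus : fusion_bialgebra F d tau.
Hypothesis dM : forall x y : A, d (conv F x y) = d x * d y.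

Local Notation J := (modular_conj F).
Local Notation "x ** y" := (conv F x y) (at level 40, left associativity).

Lemma fourierK x : (F^-1)%VF (F x) = x.
Proof. by apply: lker0_lfunK; apply/lker0P/bij_inj; case: fus. Qed.

Lemma fourierVK y : F ((F^-1)%VF y) = y.
Proof. by case: fus => _ _ _ [G _ GK] _ _ _ _; rewrite -[y]GK fourierK. Qed.

Lemma fourier_conv x y : F (x ** y) = F x * F y.
Proof. exact: fourierVK. Qed.

Lemma fourier_modular x : F (J x) = star (F x).
Proof. exact: fourierVK. Qed.

Lemma convA x y z : x ** y ** z = x ** (y ** z).
Proof. by rewrite /conv !fourierVK mulrA. Qed.

Lemma convZl (a : R[i]) x y : (a *: x) ** y = a *: (x ** y).
Proof. by rewrite /conv linearZ -scalerAl linearZ. Qed.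

Lemma convZr (a : R[i]) x y : x ** (a *: y) = a *: (x ** y).
Proof. by rewrite /conv linearZ -scalerAr linearZ. Qed.

Lemma convBl x y z : (x - y) ** z = x ** z - y ** z.
Proof. by rewrite /conv linearB mulrBl linearB. Qed.

Lemma convBr x y z : x ** (y - z) = x ** y - x ** z.
Proof. by rewrite /conv linearB mulrBr linearB. Qed.

Lemma conv_suml (f : 'I_n -> R[i]) (g : 'I_n -> A) y :
  (\sum_i f i *: g i) ** y = \sum_i f i *: (g i ** y).
Proof.
rewrite /conv linear_sum mulr_suml linear_sum; apply: eq_bigr => i _.
exact: convZl.
Qed.

Lemma conv_sumr (f : 'I_n -> R[i]) (g : 'I_n -> A) y :
  y ** (\sum_i f i *: g i) = \sum_i f i *: (y ** g i).
Proof.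
rewrite /conv linear_sum mulr_sumr linear_sum; apply: eq_bigr => i _.
exact: convZr.
Qed.

Lemma conv_ge0 x y : cpos x -> cpos y -> cpos (x ** y).
Proof. by case: fus => _ _ _ _ _ + _ _; apply. Qed.

Lemma modularM x y : J (x * y) = J x * J y.
Proof. by case: fus => _ _ _ _ _ _ [_ _ + _ _] _; apply. Qed.

Lemma modular_star x : J (star x) = star (J x).
Proof. by case: fus => _ _ _ _ _ _ [_ _ _ + _] _; apply. Qed.

Lemma modularK x : J (J x) = x.
Proof. by rewrite /modular_conj fourierVK starK fourierK. Qed.

Lemma modular1 : J 1 = 1.
Proof. by rewrite -[LHS]mulr1 -{2}[1]modularK -modularM mul1r modularK. Qed.

(** Unitarity moves both sides to [B], where [F (J x)] is the adjoint of [F x]; the right-hand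
    version also uses that [tau] is tracial. *)
Lemma frobenius_l x y z : d (star (x ** y) * z) = d (star y * (J x ** z)).
Proof.
have unitary := fb_unitary fus.
by rewrite -!unitary !fourier_conv fourier_modular starM mulrA.
Qed.

Lemma frobenius_r x y z : d (star (x ** y) * z) = d (star x * (z ** J y)).
Proof.
have [tauC _ _] := fb_tau_trace fus; have unitary := fb_unitary fus.
by rewrite -!unitary !fourier_conv fourier_modular starM -mulrA tauC mulrA.
Qed.

Lemma frobenius_pos x y z :
  cpos x -> cpos y -> d ((x ** y) * z) = d (x * (z ** J y)).
Proof.
by move=> x0 y0; rewrite -{1}(cpos_star (conv_ge0 x0 y0)) frobenius_r cpos_star.
Qed.

Lemma d_modular x : d (J x) = (d x)^*.
Proof.
have unitary := fb_unitary fus; have [tauC _ _] := fb_tau_trace fus.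
rewrite -d_star -[in LHS](mul1r (J x)) -star1 -unitary fourier_modular tauC.
by rewrite -(fourier_modular 1) modular1 unitary mulr1.
Qed.

Lemma modular_cpos x : cpos x -> cpos (J x).
Proof. by move=> [y ->]; exists (J y); rewrite modularM modular_star. Qed.

Lemma d_modular_pos x : cpos x -> d (J x) = d x.
Proof. by move=> x0; rewrite d_modular geC0_conj ?d_ge0. Qed.

Lemma modular_projection p : projection p -> projection (J p).
Proof. by move=> [sp pp]; split; rewrite -?modular_star -?modularM ?sp ?pp. Qed.

(** Paired with [z], reciprocity turns the left side into the trace of [z ** J x], which [dM]
    factors. *)
Lemma conv1l x : 1 ** x = d x *: 1.
Proof.
apply: d_nondegenerate => z.
by rewrite frobenius_r starZ -scalerAl linearZ star1 !mul1r dM d_modular mulrC.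
Qed.

Lemma conv1r x : x ** 1 = d x *: 1.
Proof.
apply: d_nondegenerate => z.
by rewrite frobenius_l starZ -scalerAl linearZ star1 !mul1r dM d_modular.
Qed.

Lemma conv_cle1 x y : cle x 1 -> cpos y -> cle (x ** y) (d y *: 1).
Proof. by move=> x1 y0; rewrite /cle -conv1l -convBl; apply: conv_ge0. Qed.

Lemma conv_cle_l x y z : cle x y -> cpos z -> cle (x ** z) (y ** z).
Proof. by move=> xy z0; rewrite /cle -convBl; apply: conv_ge0. Qed.

Lemma conv_cle_r x y z : cle x y -> cpos z -> cle (z ** x) (z ** y).
Proof. by move=> xy z0; rewrite /cle -convBr; apply: conv_ge0. Qed.

(** Convolution by [y] acts by the matrix [chi i (e j ** y)], whose entries are nonnegative when [y]
    is positive. *)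
Lemma coord_conv_sum i x y : chi i (x ** y) = \sum_j chi j x * chi i (e j ** y).
Proof.
rewrite {1}(sum_coord x) conv_suml linear_sum.
by apply: eq_bigr => j _; rewrite linearZ.
Qed.

Lemma conv_star x y : cpos y -> star x ** y = star (x ** y).
Proof.
move=> y0; apply: coord_inj => i; rewrite coord_star !coord_conv_sum rmorph_sum.
apply: eq_bigr => j _; rewrite rmorphM /= coord_star.
by have /cposP/(_ i)/geC0_conj -> := conv_ge0 (cpos_atom j) y0.
Qed.

(** * Projections carried to multiples of projections *)

(** By reciprocity [p * (q ** J y)] has the same trace as [q ** J y], which is thus supported on
    [p]; it is bounded by [d y], so it can be squeezed. *)
Lemma conv_modular p q y : projection p -> projection q -> cpos y ->
  p ** y = d y *: q -> q ** J y = d y *: p.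
Proof.
move=> pP qP y0 py; have [p0 q0] := (projection_cpos pP, projection_cpos qP).
have qy0 := conv_ge0 q0 (modular_cpos y0).
have dpq : d p * d y = d y * d q by rewrite -dM py linearZ.
have dqy : d (q ** J y) = d y * d q by rewrite dM d_modular_pos // mulrC.
apply: squeeze_projection => //.
- apply: mul_projection_d_eq => //.
  rewrite -frobenius_pos // py -scalerAl linearZ /=.
  by have [_ ->] := qP.
- rewrite -[d y]d_modular_pos //; apply: conv_cle1; first exact: projection_cle1.
  exact: modular_cpos.
- by rewrite dqy -dpq mulrC.
Qed.

(** Each [f i] is a nonnegative weighted deficit in [d (p * (p ** e i)) <= d (e i) * d p]. The
    deficits sum to zero, so there is none at an atom where [y] does not vanish. *)
Lemma conv_atom_fixed p y k : projection p -> cpos y -> p ** y = d y *: p ->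
  chi k y != 0 -> p ** e k = d (e k) *: p.
Proof.
move=> pP y0 py yk; have p0 := projection_cpos pP; have [_ pp] := pP.
have ple i : cle (p ** e i) (d (e i) *: 1).
  by apply: conv_cle1; [exact: projection_cle1|exact: cpos_atom].
pose f i := chi i y * (d (e i) * d p - d (p * (p ** e i))).
have f0 i : 0 <= f i.
  apply: mulr_ge0; first by move/cposP: y0.
  have <- : d (d (e i) *: p) = d (e i) * d p by rewrite linearZ.
  rewrite subr_ge0; apply: d_le; apply/cleP => j.
  have := (cleP _ _).1 (ple i) j; rewrite !coordM !linearZ /= coord1 mulr1 => pej.
  by rewrite mulrC ler_wpM2r //; move/cposP: p0.
have : \sum_i f i = 0.
  transitivity (d y * d p - d (p * (p ** y))); last first.
    by rewrite py -scalerAr pp linearZ subrr.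
  rewrite [y in p ** y]sum_coord conv_sumr mulr_sumr linear_sum (d_sum y).
  rewrite mulr_suml -sumrB; apply: eq_bigr => i _.
  by rewrite -scalerAr linearZ /f /= mulrBr mulrA.
move/psumr_eq0P => /(_ (fun i _ => f0 i) k isT) /eqP.
rewrite mulf_eq0 (negPf yk) subr_eq0 => /eqP dpk.
have dk : d (p ** e k) = d (e k) * d p by rewrite dM mulrC.
apply: squeeze_projection => //; apply: mul_projection_d_eq => //.
  by apply: conv_ge0 => //; exact: cpos_atom.
by rewrite -dpk dk.
Qed.

(** The element lies between 0 and 1; reciprocity rewrites the trace of its square through
    [p ** (q ** J q)], which gives [d p], its own trace. *)
Lemma shift_projection p q : projection p -> projection q -> d q != 0 ->
    p ** (q ** J q) = (d q * d q) *: p ->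
  projection ((d q)^-1 *: (p ** q)).
Proof.
move=> pP qP dq0 pqq; have [p0 q0] := (projection_cpos pP, projection_cpos qP).
have [_ pp] := pP; have dqi0 : 0 <= (d q)^-1 by rewrite invr_ge0 d_ge0.
apply: projection_of_d_sqr.
- by apply: cposZ => //; apply: conv_ge0.
- have /cleP pq1 := conv_cle1 (projection_cle1 pP) q0.
  apply/cleP => i; have := pq1 i; rewrite !linearZ /= coord1 mulr1 => pqi.
  by rewrite mulrC ler_pdivrMr ?mul1r // lt_neqAle eq_sym dq0 d_ge0.
- rewrite -scalerAl -scalerAr !linearZ /= frobenius_pos // convA pqq -scalerAr pp.
  by rewrite linearZ /= dM; field.
Qed.

(** * The stabilizer biprojection: (2) implies (3) *)

(** The witness is the sum of the atoms that fix [p] up to their trace; [conv_atom_fixed] gives its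
    maximality. *)
Lemma exists_stabilizer p : projection p -> exists b : A,
  [/\ projection b, p ** b = d b *: p &
      forall y, cpos y -> p ** y = d y *: p -> b * y = y].
Proof.
move=> pP; pose f i : R[i] := (p ** e i == d (e i) *: p)%:R.
have bE i : chi i (\sum_j f j *: e j) = f i by exact: coord_sum.
exists (\sum_j f j *: e j); split.
- by apply/projectionP => i; rewrite bE /f; case: (_ == _); rewrite ?oner_eq0 ?eqxx.
- rewrite conv_sumr linear_sum scaler_suml; apply: eq_bigr => i _.
  rewrite linearZ -scalerA /= /f; case: eqP => [->|_] //.
  by rewrite !scale0r.
- move=> y y0 py; apply: coord_inj => i; rewrite coordM bE /f.
  have [->|yi] := eqVneq (chi i y) 0; first by rewrite mulr0.
  by rewrite (conv_atom_fixed pP y0 py yi) eqxx mul1r.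
Qed.

Lemma exists_conv_unit : exists u : A,
  [/\ cpos u, d u = 1, forall y, y ** u = y, forall y, u ** y = y &
      exists (c : R[i]) (p : A), [/\ 0 < c, projection p & u = c *: p]].
Proof.
have [c [p [c0 [pP _ _] uE]]] := fb_jones fus.
have unitl y : (F^-1)%VF 1 ** y = y by rewrite /conv fourierVK mul1r fourierK.
have unitr y : y ** (F^-1)%VF 1 = y by rewrite /conv fourierVK mulr1 fourierK.
exists ((F^-1)%VF 1); split=> //.
- by rewrite uE; apply: cposZ; [exact: ltW|exact: projection_cpos].
- by apply: (mulfI (lt0r_neq0 d1_gt0)); rewrite -dM unitr mulr1.
- by exists c, p.
Qed.

(** If [y] fixes [p] up to its trace, so does [b ** y], which is hence supported on [b] and
    squeezed. The convolution unit and [J b] fix [p] too: so [b] is nonzero and [J b = b], which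
    makes [F b / d b] a projection. *)
Lemma stabilizer_biprojection p b : projection p -> projection b ->
    p ** b = d b *: p -> (forall y, cpos y -> p ** y = d y *: p -> b * y = y) ->
  [/\ b <> 0, biprojection F b,
      forall y, cpos y -> p ** y = d y *: p -> b ** y = d y *: b &
      forall q, cpos q -> exists a : R[i], cle q (a *: (b ** q))].
Proof.
move=> pP bP pb stab; have b0 := projection_cpos bP; have [_ bbE] := bP.
have b_conv y : cpos y -> p ** y = d y *: p -> b ** y = d y *: b.
  move=> y0 py; apply: squeeze_projection => //; last by rewrite dM mulrC.
    apply: stab; first exact: conv_ge0.
    by rewrite -convA pb convZl py scalerA dM.
  exact: conv_cle1 (projection_cle1 bP) y0.
have [u [u0 du unitr unitl [c [f [c0 fP uE]]]]] := exists_conv_unit.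
have bu : b * u = u.
  by apply: stab => //; rewrite du scale1r; apply: unitr.
have bn0 : b <> 0.
  move=> b_eq0; move: du; rewrite -bu b_eq0 mul0r linear0.
  by move/esym/eqP; rewrite oner_eq0.
split=> //.
- have db0 := lt0r_neq0 (d_projection_gt0 bP bn0).
  have bb := b_conv b b0 pb.
  have Jb : J b = b.
    have JbP := modular_projection bP.
    apply: cle_d_eq; last by rewrite d_modular_pos.
    apply: cle_mul_projection => //; apply: stab; first exact: modular_cpos.
    by rewrite d_modular_pos //; apply: conv_modular.
  split=> //; exists (d b), ((d b)^-1 *: F b); split; last first.
    by rewrite scalerA divff ?scale1r.
  split.
    rewrite starZ -fourier_modular Jb.
    by rewrite -[in RHS](geC0_conj (_ : 0 <= (d b)^-1)) // invr_ge0 d_ge0.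
  rewrite -scalerAl -scalerAr -fourier_conv bb; congr (_ *: _).
  by rewrite linearZ scalerA mulVf // scale1r.
(* The convolution unit is [c *: f] with [f] below [b], so [q = c *: (f ** q)] is below
   [c *: (b ** q)]. *)
- move=> q q0; exists c.
  have fb : cle f b.
    apply: cle_mul_projection => //; apply: (scalerI (lt0r_neq0 c0)).
    by rewrite scalerAr -uE bu.
  rewrite -{1}(unitl q) uE convZl /cle -scalerBr; apply: cposZ; first exact: ltW.
  exact: conv_cle_l.
Qed.

Lemma exists_biprojection p q : (p = 0 -> (1 < \dim {:A})%N) ->
    projection p -> projection q -> q <> 0 ->
    projection ((d q)^-1 *: (p ** q)) ->
  exists b r x : A, [/\ biprojection F b, right_shift F d b r, cle q r, x <> 0 &
    p = range_projection (x ** b)].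
Proof.
move=> dim_gt1 pP qP qn0; set p' := _ *: _ => p'P.
have [p0 q0] := (projection_cpos pP, projection_cpos qP).
have dq0 : d q != 0 by apply/lt0r_neq0/d_projection_gt0.
have Jq0 := modular_cpos q0.
have pq : p ** q = d q *: p' by rewrite scalerA divff ?scale1r.
have [b [bP pb stab]] := exists_stabilizer pP; have b0 := projection_cpos bP.
have [bn0 bip b_conv b_unit] := stabilizer_biprojection pP bP pb stab.
(* Convolution by [q] leads from [p] to [p'] and [J q] leads back, so [q ** J q] fixes [p] up to its
   trace. *)
have bqq : b ** (q ** J q) = (d q * d q) *: b.
  rewrite b_conv ?dM ?d_modular_pos //; first exact: conv_ge0.
  by rewrite -convA pq convZl (conv_modular pP p'P q0 pq) scalerA.
have rP := shift_projection bP qP dq0 bqq.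
exists b, ((d q)^-1 *: (b ** q)).
have shift : right_shift F d b ((d q)^-1 *: (b ** q)).
  split=> //; first by rewrite linearZ /= dM mulrCA mulVf ?mulr1.
  by rewrite convZr -convA b_conv // convZl scalerA mulrC -scalerA.
have q_le : cle q ((d q)^-1 *: (b ** q)).
  apply: cle_mul_projection => //; have [a qa] := b_unit q q0.
  apply: (@mul_projection_cle (a * d q)) => //.
  by rewrite scalerA mulfK.
have [p_eq0|pn0] := eqVneq p 0; last first.
  exists p; split=> //; first exact/eqP.
  rewrite pb range_projectionZ ?range_projection_id //.
  exact/lt0r_neq0/d_projection_gt0.
have [x xn0 dx0] : exists2 x : A, x <> 0 & d x = 0.
  have [y yN1] : exists y : A, y \notin <[1 : A]>%VS.
    apply: contrapT => all1; have := dim_gt1 p_eq0.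
    suff /dimvS : ({:A} <= <[1 : A]>)%VS.
      by rewrite dim_vline oner_eq0 leqNgt => /negP.
    by apply/subvP => y _; apply: contrapT => /negP yN1; apply: all1; exists y.
  have d1 := lt0r_neq0 d1_gt0.
  (* Removing the trace part leaves a nonzero element, as [y] is not a multiple of [1]. *)
  exists (y - (d y / d 1) *: 1); last by rewrite linearB linearZ /= divfK ?subrr.
  by move=> /eqP; rewrite subr_eq0 => /eqP y1; case/vlineP: yN1; exists (d y / d 1).
exists x; split=> //.
(* For [p = 0] every positive element satisfies the fixing equation, in particular [1]. *)
have b1 : b = 1.
  rewrite -[LHS]mulr1; apply: stab; first exact/projection_cpos/projection1.
  by rewrite p_eq0 conv1r linear0 scaler0 scale0r.
rewrite b1 conv1r dx0 scale0r p_eq0; apply: coord_inj => i.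
by rewrite coord_range linear0 eqxx.
Qed.


(** * Size of the support: (1) is equivalent to (2) *)

(** The normalized convolution [v] has trace [d p] and [0 <= v <= 1], so it lies below its range
    projection, with equality as soon as the traces agree. *)
Lemma supp_size_conv_eq p q : projection p -> projection q -> q <> 0 ->
  supp_size d (p ** q) = supp_size d p <->
  projection ((supp_size d q)^-1 *: (p ** q)).
Proof.
move=> pP qP qn0; have [p0 q0] := (projection_cpos pP, projection_cpos qP).
rewrite /supp_size (range_projection_id pP) (range_projection_id qP).
have dq0 : 0 < d q by exact: d_projection_gt0.
have dqi0 : (d q)^-1 != 0 by rewrite invr_eq0 gt_eqF.
set v := _ *: _; rewrite -(range_projectionZ _ dqi0) -/v.
have dv : d v = d p by rewrite linearZ /= dM mulrCA mulVf ?mulr1 ?gt_eqF.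
split=> [dRv|vP]; last by rewrite range_projection_id.
suff -> : v = range_projection v by exact: projection_range.
apply: cle_d_eq; last by rewrite dv.
apply/cleP => i; rewrite coord_range.
have [->//|_] := eqVneq.
have /cleP/(_ i) := conv_cle1 (projection_cle1 pP) q0.
rewrite /v !linearZ /= coord1 mulr1 mulr1n => pqi.
by rewrite mulrC (ler_pdivrMr _ _ dq0) mul1r.
Qed.

(** * From biprojections to projections: (3) implies (2) *)

(** Where [w] vanishes, a sum of nonnegative terms is zero, so no atom of the support of [w]
    contributes there: the convolution stays supported on the range. *)
Lemma conv_range_fixed w b : cpos w -> projection b -> w ** b = d b *: w ->
  range_projection w ** b = d b *: range_projection w.
Proof.
move=> w0 bP wb; have b0 := projection_cpos bP.
have RP := projection_range w; have R0 := projection_cpos RP.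
have N0 i j : 0 <= chi i (e j ** b).
  by have /cposP := conv_ge0 (cpos_atom j) b0.
apply: squeeze_projection => //; last by rewrite dM mulrC.
  apply: coord_inj => i; rewrite coordM coord_range.
  have [wi0|] := eqVneq (chi i w) 0; last by rewrite mul1r.
  rewrite mul0r coord_conv_sum big1 // => j _; rewrite coord_range.
  have : \sum_j chi j w * chi i (e j ** b) = 0.
    by rewrite -coord_conv_sum wb linearZ /= wi0 mulr0.
  have wN0 k : 0 <= chi k w * chi i (e k ** b).
    by rewrite mulr_ge0 //; move/cposP: w0.
  move/psumr_eq0P => /(_ (fun k _ => wN0 k) j isT)/eqP; rewrite mulf_eq0.
  by case: (chi j w == 0) => /= [_|/eqP ->]; rewrite ?mul0r ?mulr0.
exact: conv_cle1 (projection_cle1 RP) b0.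
Qed.

(* Kadison-Schwarz: evaluating [|z - z_i|^2 ** b >= 0] at the atom [i] gives
   [|z|^2 ** b >= d b |z|^2], and both sides have the same trace. *)
Lemma conv_sqr_fixed z b : projection b -> z ** b = d b *: z ->
  (star z * z) ** b = d b *: (star z * z).
Proof.
move=> bP zb; have b0 := projection_cpos bP.
have db_real : (d b)^* = d b by rewrite geC0_conj ?d_ge0.
apply/esym/cle_d_eq; last by rewrite linearZ dM mulrC.
apply/cleP => i; set c := chi i z.
have /cposP/(_ i) : cpos ((star (z - c *: 1) * (z - c *: 1)) ** b).
  by apply: conv_ge0 => //; exists (z - c *: 1).
have -> : star (z - c *: 1) * (z - c *: 1) =
    star z * z - c *: star z - (c^* *: z - (c^* * c) *: 1).
  rewrite starB starZ star1 mulrBl !mulrBr -!scalerAr -!scalerAl mulr1 mul1r.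
  by rewrite scalerA mul1r (mulrC c).
rewrite !convBl !convZl conv_star // zb conv1l. rewrite !coordB !coordZ coord_star.
rewrite coordZ coord1 rmorphM /= db_real coordM coord_star -/c.
suff -> : chi i ((star z * z) ** b) - c * (d b * c^*) -
    (c^* * (d b * c) - c^* * c * (d b * 1)) =
    chi i ((star z * z) ** b) - d b * (c^* * c) by rewrite subr_ge0.
by ring.
Qed.

(** Reciprocity with [b ** r = d b *: r] shows that [r ** J r] is supported on [b]; bound and trace
    finish. *)
Lemma right_shift_modular b r : projection b -> b ** b = d b *: b ->
  right_shift F d b r -> r ** J r = d b *: b.
Proof.
move=> bP bb [rP dbr br]; have [b0 r0] := (projection_cpos bP, projection_cpos rP).
have [_ rr] := rP; have Jr0 := modular_cpos r0.
have dr : d (r ** J r) = d b * d b by rewrite dM d_modular_pos // dbr.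
apply: squeeze_projection => //.
  apply: mul_projection_d_eq => //; first exact: conv_ge0.
  by rewrite -frobenius_pos // br -scalerAl rr linearZ dr /= -dbr.
rewrite dbr -[d r]d_modular_pos //; apply: conv_cle1 => //.
exact: projection_cle1.
Qed.

Lemma biprojection_conv b : biprojection F b -> b <> 0 -> b ** b = d b *: b.
Proof.
move=> [bP [c [q [[_ qq] Fb]]]] bn0; have db0 := d_projection_gt0 bP bn0.
have bb : b ** b = c *: b.
  by rewrite -[RHS]fourierK linearZ /= {1}/conv Fb -scalerAl -scalerAr qq.
have /(congr1 d) := bb; rewrite dM linearZ /= => /(mulIf (lt0r_neq0 db0)) dbc.
by rewrite bb dbc.
Qed.

Lemma projection_conv_of_right_shift b r x q :
    biprojection F b -> right_shift F d b r -> projection q -> q <> 0 ->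
    cle q r ->
  projection ((d q)^-1 *: (range_projection (x ** b) ** q)).
Proof.
move=> bip shift qP qn0 qr; have [bP _] := bip; have [rP dbr _] := shift.
have [b0 q0] := (projection_cpos bP, projection_cpos qP).
have dr_gt0 : 0 < d r by apply: lt_le_trans (d_le qr); exact: d_projection_gt0.
have bb : b ** b = d b *: b.
  apply: biprojection_conv => // b_eq0.
  by move: dr_gt0; rewrite -dbr b_eq0 linear0 ltxx.
set p := range_projection (x ** b).
have pP : projection p by exact: projection_range.
have pb : p ** b = d b *: p.
  have zb : x ** b ** b = d b *: (x ** b) by rewrite convA bb convZr.
  (* [x ** b] need not be positive, but its squared modulus is and has the same range. *)
  have -> : p = range_projection (star (x ** b) * (x ** b)).
    apply: coord_inj => i; rewrite !coord_range coordM coord_star.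
    by rewrite [in RHS]mulf_eq0 conjC_eq0 orbb.
  apply: conv_range_fixed => //; first by exists (x ** b).
  exact: conv_sqr_fixed.
have yP : projection ((d r)^-1 *: (p ** r)).
  apply: shift_projection => //; first exact: lt0r_neq0.
  by rewrite (right_shift_modular bP bb shift) convZr pb scalerA dbr.
set y := _ *: _ in yP.
have pr : p ** r = d r *: y by rewrite scalerA divff ?scale1r ?lt0r_neq0.
have p0 := projection_cpos pP.
have dy : d y = d p by rewrite linearZ /= dM mulrCA mulVf ?mulr1 ?lt0r_neq0.
have dq0 : d q != 0 by apply/lt0r_neq0/d_projection_gt0.
(* As [q] is below [r], [p ** q] is below [d r *: y], hence supported on [y]. *)
suff -> : p ** q = d q *: y by rewrite scalerA mulVf ?scale1r.
apply: squeeze_projection => //.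
- apply: (@mul_projection_cle (d r)) => //; first exact: conv_ge0.
  by rewrite -pr; exact: conv_cle_r.
- by apply: conv_cle1 => //; exact: projection_cle1.
- by rewrite dM dy mulrC.
Qed.

End Fusion.
End Coordinates.

(** [hQ0] makes the division by the size of [Q] meaningful. [hP0] excludes [P = 0] in a
    one-dimensional [A]: there (1) and (2) hold, but [Q <= bh] forces [b = 1], and
    [conv F x 1 = d x *: 1] is nonzero for nonzero [x]. *)
Theorem theorem6p17 (R : realType) (A B : finCstarAlgType R)
    (F : 'Hom(A, B)) (d : {scalar A}) (tau : {scalar B})
    (hfb : fusion_bialgebra F d tau)
    (hd : forall x y : A, d (conv F x y) = d x * d y)
    (P Q : A) (hP : projection P) (hQ : projection Q)
    (hQ0 : Q <> 0) (hP0 : P = 0 -> (1 < \dim {:A})%N) :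
  (supp_size d (conv F P Q) = supp_size d P <->
   projection ((supp_size d Q)^-1 *: conv F P Q)) /\
  (projection ((supp_size d Q)^-1 *: conv F P Q) <->
   exists b bh x : A,
     [/\ biprojection F b, right_shift F d b bh, cle Q bh,
         x <> 0 & P = range_projection (conv F x b)]).
Proof.
have [mulC tr _ _ _ _ _ _] := hfb.
have [n [e basis]] := exists_atomic_basis mulC tr.
split; first exact: (supp_size_conv_eq mulC tr basis hfb hd).
rewrite /supp_size (range_projection_id mulC tr basis hQ); split.
  exact: (exists_biprojection mulC tr basis hfb hd).
move=> [b [r [x [bip shift qr _ ->]]]].
exact: (projection_conv_of_right_shift mulC tr basis hfb hd x bip shift).
Qed.
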